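(* Let $\gamma$ be an $n$-Frenet curve, with curvatures $k_1,\dots,k_{n-1}$, parametrized by the arc length $s$ in an $m$-dimensional semi-Riemannian space form $N^m_t(c)$, $1\le t\le m-1$, $m\ge n\ge4$. Then $\gamma$ is proper biharmonic if and only if $$\begin{cases}k_1=\kappa_1=\text{constant}>0\\ k_2=\kappa_2=\text{constant}>0\\ \epsilon_1k_1^2+\epsilon_3k_2^2=c\,\epsilon_1\epsilon_2\\ \epsilon_3k_2k_3=0.\end{cases}$$ In particular, there exists no proper biharmonic, full $n$-Frenet curve in $N^m_t(c)$, $m\ge n\ge4$.
   Context: Conventions. For a semi-Riemannian manifold $(M,\langle\,,\rangle)$ with Levi-Civita connection $\nabla$, $R(X,Y)Z=\nabla_X\nabla_YZ-\nabla_Y\nabla_XZ-\nabla_{[X,Y]}Z$. Curves $\gamma:I\to M$ ($I$ an open real interval) are smooth, nonnull, parametrized by arc length; $T=\gamma'$. A curve is biharmonic if $\tau_2(\gamma)=\nabla_T\nabla_T\nabla_TT+R(\nabla_TT,T)T=0$, and proper biharmonic if it is biharmonic and not a geodesic. An $n$-Frenet curve (Frenet curve of order $n\le m=\dim M$) is a curve admitting a frame field $\{F_1=T,F_2,\dots,F_n\}$ along it with $\langle F_j,F_j\rangle=\epsilon_j=\pm1$, $\langle F_i,F_j\rangle=0$ for $i\ne j$, and $$\nabla_TF_1=\epsilon_2k_1F_2,\quad \nabla_TF_i=-\epsilon_{i-1}k_{i-1}F_{i-1}+\epsilon_{i+1}k_iF_{i+1}\ (1<i<n),\quad \nabla_TF_n=-\epsilon_{n-1}k_{n-1}F_{n-1},$$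 where the curvatures $k_1(s),\dots,k_{n-1}(s)$ are positive smooth functions (if $M$ is oriented and $n=m$, $k_{n-1}$ is allowed to take any real value, $F_n$ being fixed by requiring $\{F_1,\dots,F_n\}$ to be positively oriented). It is full if $k_{n-1}(s)$ never vanishes. Space forms: let $\mathbb{R}^d_t$ be $\mathbb{R}^d$ with $\langle x,y\rangle=-\sum_{i=1}^t x_iy_i+\sum_{i=t+1}^d x_iy_i$. $N^m_t(c)$ denotes $\mathbb{R}^m_t$ if $c=0$, $\{x\in\mathbb{R}^{m+1}_t:\langle x,x\rangle=1/c\}$ if $c>0$, $\{x\in\mathbb{R}^{m+1}_{t+1}:\langle x,x\rangle=1/c\}$ if $c<0$, with the induced metric of index $t$; its curvature is $R(X,Y)Z=c(\langle Y,Z\rangle X-\langle X,Z\rangle Y)$. *)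

(* Defs.v *)
From HB Require Import structures.
From mathcomp Require Import all_boot all_order all_algebra.
From mathcomp Require Import all_classical all_reals all_analysis.

Set Implicit Arguments.
Unset Strict Implicit.
Unset Printing Implicit Defensive.

Import Order.TTheory GRing.Theory Num.Theory.
Import numFieldNormedType.Exports.

Local Open Scope classical_set_scope.
Local Open Scope ring_scope.

(* Smoothness is only required on I; since I is open in every use, the total
   library derivatives at points of I do not see the values outside I. *)
Definition smooth_on (R : realType) (V : normedModType R) (I : set R)
    (f : R -> V) : Prop :=
  forall (k : nat) (s : R), I s -> derivable (derive1n k f) s 1.

Definition open_interval (R : realType) (I : set R) : Prop :=
  [/\ open I, is_interval I & I !=set0].

(* The scalar product of index t on R^d: the first t coordinates are the
   negative ones. *)
Definition sdot (R : realType) (d t : nat) (x y : 'rV[R]_d) : R :=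
  \sum_(i < d) (if (i < t)%N then - (x ord0 i * y ord0 i)
                else x ord0 i * y ord0 i).

(* N^m_t(c) lies in R^m_t if c = 0, in R^(m+1)_t if c > 0 and in
   R^(m+1)_(t+1) if c < 0. *)
Definition amb_dim (R : realType) (m : nat) (c : R) : nat :=
  if c == 0 then m else m.+1.

Definition amb_index (R : realType) (t : nat) (c : R) : nat :=
  if c < 0 then t.+1 else t.

Section SpaceForm.
Context {R : realType} (m t : nat) (c : R).

Local Notation vec := 'rV[R]_(amb_dim m c).

Definition sprod (x y : vec) : R := sdot (amb_index t c) x y.

Definition space_form : set vec := [set x | c != 0 -> sprod x x = c^-1].

Definition tangent_space (p : vec) : set vec :=
  [set v | c != 0 -> sprod p v = 0].

(* Orthogonal projection of the ambient space onto the tangent space at a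
   point p of the space form: for c != 0 the position vector p spans the normal
   line and <p,p> = 1/c; for c = 0 it is the identity. *)
Definition tangent_proj (p v : vec) : vec := v - (c * sprod v p) *: p.

(* Covariant derivative along gamma for the Levi-Civita connection of the
   induced metric: the tangential part of the ambient derivative. *)
Definition cov_deriv (gamma V : R -> vec) : R -> vec :=
  fun s => tangent_proj (gamma s) (derive1 V s).

Definition curvature (X Y Z : vec) : vec :=
  c *: (sprod Y Z *: X - sprod X Z *: Y).

Definition unit_speed_curve (I : set R) (gamma : R -> vec) : Prop :=
  [/\ smooth_on I gamma,
      forall s, I s -> space_form (gamma s) &
      forall s, I s -> `|sprod (derive1 gamma s) (derive1 gamma s)| = 1].

Definition bitension (gamma : R -> vec) (s : R) : vec :=
  let T := derive1 gamma in
  let D := cov_deriv gamma in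
  D (D (D T)) s + curvature (D T s) (T s) (T s).

Definition biharmonic (I : set R) (gamma : R -> vec) : Prop :=
  forall s, I s -> bitension gamma s = 0.

Definition geodesic (I : set R) (gamma : R -> vec) : Prop :=
  forall s, I s -> cov_deriv gamma (derive1 gamma) s = 0.

Definition proper_biharmonic (I : set R) (gamma : R -> vec) : Prop :=
  biharmonic I gamma /\ ~ geodesic I gamma.

(* For c = 0 the rows are F_1, ..., F_m; for c != 0 they are gamma (the normal
   direction) followed by F_1, ..., F_m. *)
Definition frame_matrix (gamma : R -> vec) (F : nat -> R -> vec) (s : R)
    : 'M[R]_(amb_dim m c) :=
  \matrix_(i < amb_dim m c)
    (if c == 0 then F i.+1 s
     else if (i : nat) == 0%N then gamma s else F (i : nat) s).

(* [o] records the orientation carried by the space form: [None] when none is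
   fixed, [Some b] for one of the two orientations, for which a tangent basis
   is positive when (-1)^b times the determinant above is positive. *)
Definition positively_oriented (o : option bool) (gamma : R -> vec)
    (F : nat -> R -> vec) (s : R) : Prop :=
  forall b : bool, o = Some b -> 0 < (-1) ^+ b * \det (frame_matrix gamma F s).

(* F_1, ..., F_n, eps_1, ..., eps_n and k_1, ..., k_(n-1) are families indexed
   by nat, numbered from 1; their other members are irrelevant.  The last
   curvature of an n-Frenet curve with n = m may have any sign if the space
   form is oriented. *)
Record frenet_curve (o : option bool) (n : nat) (I : set R)
    (gamma : R -> vec) (eps : nat -> R) (F : nat -> R -> vec)
    (k : nat -> R -> R) : Prop := FrenetCurve {
  frenet_unit_speed : unit_speed_curve I gamma;
  frenet_F1 : forall s, I s -> F 1%N s = derive1 gamma s;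
  frenet_F_smooth : forall i, (1 <= i <= n)%N -> smooth_on I (F i);
  frenet_F_tangent : forall i, (1 <= i <= n)%N ->
    forall s, I s -> tangent_space (gamma s) (F i s);
  frenet_eps : forall i, (1 <= i <= n)%N -> eps i = 1 \/ eps i = -1;
  frenet_norm : forall i, (1 <= i <= n)%N ->
    forall s, I s -> sprod (F i s) (F i s) = eps i;
  frenet_orth : forall i j, (1 <= i <= n)%N -> (1 <= j <= n)%N -> i <> j ->
    forall s, I s -> sprod (F i s) (F j s) = 0;
  frenet_eq : forall i, (1 <= i <= n)%N -> forall s, I s ->
    cov_deriv gamma (F i) s =
      (if (1 < i)%N then - ((eps i.-1 * k i.-1 s) *: F i.-1 s) else 0)
      + (if (i < n)%N then (eps i.+1 * k i s) *: F i.+1 s else 0);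
  frenet_k_smooth : forall i, (1 <= i < n)%N -> smooth_on I (k i : R -> R^o);
  frenet_k_pos : forall i, (1 <= i < n)%N ->
    ~ [/\ isSome o, n = m & i = n.-1] ->
    forall s, I s -> 0 < k i s;
  frenet_oriented : n = m ->
    forall s, I s -> positively_oriented o gamma F s }.

Definition full_frenet (n : nat) (I : set R) (k : nat -> R -> R) : Prop :=
  forall s, I s -> k n.-1 s <> 0.

End SpaceForm.

Lemma sdotC (R : realType) (d t : nat) (x y : 'rV[R]_d) :
  sdot t x y = sdot t y x.
Proof. by apply: eq_bigr => i _; rewrite mulrC. Qed.

Lemma sdotBr (R : realType) (d t : nat) (x y z : 'rV[R]_d) :
  sdot t x (y - z) = sdot t x y - sdot t x z.
Proof.
rewrite /sdot -sumrB; apply: eq_bigr => i _; rewrite !mxE mulrBr.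
by case: ifP => // _; rewrite opprD.
Qed.

Lemma sdotZr (R : realType) (d t : nat) (a : R) (x y : 'rV[R]_d) :
  sdot t x (a *: y) = a * sdot t x y.
Proof.
rewrite /sdot mulr_sumr; apply: eq_bigr => i _; rewrite !mxE mulrCA.
by case: ifP => // _; rewrite mulrN.
Qed.

Lemma tangent_proj_tangent (R : realType) (m t : nat) (c : R)
    (p v : 'rV[R]_(amb_dim m c)) :
  space_form t p -> tangent_space t p (tangent_proj t p v).
Proof.
move=> pN c0; rewrite /tangent_proj /sprod sdotBr sdotZr.
move: (pN c0); rewrite /sprod => ->.
by rewrite mulrAC mulfV // mul1r sdotC subrr.
Qed.

Lemma tangent_proj_orthogonal (R : realType) (m t : nat) (c : R)
    (p v w : 'rV[R]_(amb_dim m c)) :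
  tangent_space t p w -> sprod t w (v - tangent_proj t p v) = 0.
Proof.
move=> wT; rewrite /tangent_proj subKr /sprod sdotZr.
have [c0 | c0] := eqVneq c 0; first by rewrite [X in X * _ * _]c0 !mul0r.
by move: (wT c0); rewrite /sprod [sdot _ p w]sdotC => ->; rewrite mulr0.
Qed.

(* Main.v *)
(* In a space form R(D_T T, T)T = c eps_1 D_T T, so differentiating the Frenet
   equations three times gives, with k_i' the derivative along the curve,
     tau_2 = -3 eps_1 eps_2 k_1 k_1' F_1
           + (eps_2 k_1'' + k_1 (c eps_1 eps_2 - eps_1 k_1^2 - eps_3 k_2^2)) F_2
           + eps_2 eps_3 (2 k_1' k_2 + k_1 k_2') F_3
           + eps_2 eps_3 eps_4 k_1 k_2 k_3 F_4.
   Since n >= 4, both k_1 and k_2 are positive and F_1, ..., F_4 are linearly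
   independent, so tau_2 = 0 forces k_1' = 0, k_2' = 0 and the two algebraic
   conditions.  A full curve has k_3 <> 0, contradicting the last of them. *)
Require Import Defs.
From HB Require Import structures.
From mathcomp Require Import all_boot all_order all_algebra.
From mathcomp Require Import all_classical all_reals all_analysis.
From mathcomp Require Import ring.

Set Implicit Arguments.
Unset Strict Implicit.
Unset Printing Implicit Defensive.

Import Order.TTheory GRing.Theory Num.Theory.
Import numFieldNormedType.Exports.

Local Open Scope classical_set_scope.
Local Open Scope ring_scope.

(** * Differentiation on an open interval *)

Lemma eq_on_derive1 (R : realType) (V : normedModType R) (I : set R)
    (f g : R -> V) (s : R) :
  open I -> I s -> (forall x, I x -> f x = g x) -> derive1 f s = derive1 g s.
Proof.
(* The open set [I] is a neighbourhood of [s], and a derivative depends only on the germ of the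
   function. *)
move=> oI Is fg; rewrite !derive1E; apply: near_eq_derive.
by near=> x; apply: fg; near: x; exact: open_nbhs_nbhs.
Unshelve. all: by end_near. Qed.

Lemma eq_cst_derive1 (R : realType) (V : normedModType R) (I : set R)
    (f : R -> V) (a : V) (s : R) :
  open I -> I s -> (forall x, I x -> f x = a) -> derive1 f s = 0.
Proof.
by move=> oI Is fa; rewrite (eq_on_derive1 (g := cst a) oI Is fa) derive1_cst.
Qed.

(** Mean value theorem on the segment from [a] to [b], which stays in [I] because [I] is an
    interval. *)
Lemma derive1_eq0_cst (R : realType) (I : set R) (f : R -> R) :
  is_interval I -> (forall s, I s -> derivable f s 1) ->
  (forall s, I s -> derive1 f s = 0) ->
  forall a b, I a -> I b -> f a = f b.
Proof.
move=> Iitv df f0 a b.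
wlog ab : a b / a <= b => [H Ia Ib|Ia Ib].
  by have [/H->//|/ltW/H->] := leP a b.
have subI x : a <= x <= b -> I x by apply: (Iitv a b).
have [x xab|x|x xab] := @MVT_segment _ f (derive1 f) a b ab.
- rewrite derive1E; apply: derivableP; apply: df; apply: subI.
  by rewrite !ltW ?(itvP xab).
- apply: derivable_within_continuous => y; rewrite in_itv /= => yab.
  exact/df/subI.
rewrite f0 ?mul0r; last by apply: subI; rewrite !(itvP xab).
by move/eqP; rewrite subr_eq0 => /eqP.
Qed.

(** Derivability and derivatives of row vectors are read off coordinatewise, which reduces the claim
    to the product rule for real functions. *)
Lemma is_derive_scale_rV (R : realType) (d : nat) (f : R -> R^o)
    (V : R -> 'rV[R]_d) (s : R) (df : R^o) (dV : 'rV[R]_d) :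
  is_derive s 1 f df -> is_derive s 1 V dV ->
  is_derive s 1 (fun x => f x *: V x) (f s *: dV + df *: V s).
Proof.
move=> [ef <-] [eV <-].
have eVj := (derivable_mxP V s 1).1 eV.
have E i j : (fun x => (f x *: V x) i j) = f * (fun x => V x i j).
  by apply/funext => x; rewrite !mxE.
have efV : derivable (fun x => f x *: V x) s 1.
  by apply/derivable_mxP => i j; rewrite E; exact: derivableM ef (eVj i j).
split; first exact: efV.
rewrite (derive_mx efV) (derive_mx eV); apply/matrixP => i j.
by rewrite !mxE E (deriveM ef (eVj i j)) [V s i j *: _]mulrC.
Qed.

(** * Bilinearity of the scalar product and linearity of the tangential projection *)

Section ScalarProduct.
Context (R : realType) (m t : nat) (c : R).
Implicit Types x y z p : 'rV[R]_(amb_dim m c).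

Lemma sprodC x y : sprod t x y = sprod t y x.
Proof. exact: sdotC. Qed.

Lemma sprodZr a x y : sprod t x (a *: y) = a * sprod t x y.
Proof. exact: sdotZr. Qed.

Lemma sprodDr x y z : sprod t x (y + z) = sprod t x y + sprod t x z.
Proof.
have -> : y + z = y - (-1) *: z by rewrite scaleN1r opprK.
by rewrite {1}/sprod sdotBr sdotZr mulN1r opprK.
Qed.

Lemma sprodDl x y z : sprod t (y + z) x = sprod t y x + sprod t z x.
Proof. by rewrite sprodC sprodDr ![sprod t x _]sprodC. Qed.

Lemma sprodZl a x y : sprod t (a *: y) x = a * sprod t y x.
Proof. by rewrite sprodC sprodZr sprodC. Qed.

Lemma tangent_projD p x y :
  tangent_proj t p (x + y) = tangent_proj t p x + tangent_proj t p y.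
Proof.
by rewrite /tangent_proj sprodDl mulrDr scalerDl opprD addrACA.
Qed.

Lemma tangent_projZ p a x : tangent_proj t p (a *: x) = a *: tangent_proj t p x.
Proof. by rewrite /tangent_proj sprodZl mulrCA scalerBr scalerA. Qed.

Lemma tangent_proj_id p x : tangent_space t p x -> tangent_proj t p x = x.
Proof.
move=> px; rewrite /tangent_proj.
(* Tangency says nothing when [c = 0]; there the factor [c] already removes the normal term. *)
have [c0|c0] := eqVneq c 0; first by rewrite [X in X * _]c0 mul0r scale0r subr0.
by rewrite sprodC px // mulr0 scale0r subr0.
Qed.

End ScalarProduct.

(** * Locality, additivity and the Leibniz rule for the covariant derivative *)

Section CovariantDerivative.
Context (R : realType) (m t : nat) (c : R).
Context (gamma : R -> 'rV[R]_(amb_dim m c)).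
Implicit Types V W : R -> 'rV[R]_(amb_dim m c).

Lemma eq_on_cov_deriv (I : set R) V W s :
  open I -> I s -> (forall x, I x -> V x = W x) ->
  cov_deriv t gamma V s = cov_deriv t gamma W s.
Proof. by move=> oI Is VW; rewrite /cov_deriv (eq_on_derive1 oI Is VW). Qed.

Lemma cov_derivD V W s : derivable V s 1 -> derivable W s 1 ->
  cov_deriv t gamma (fun x => V x + W x) s =
  cov_deriv t gamma V s + cov_deriv t gamma W s.
Proof.
by move=> dV dW; rewrite /cov_deriv !derive1E (deriveD dV dW) tangent_projD.
Qed.

(** The projection distributes over the two terms of the ambient product rule. Tangency of [V s]
    lets the term carrying the derivative of [a] pass through unchanged. *)
Lemma cov_derivZ (a : R -> R^o) V s :
  derivable a s 1 -> derivable V s 1 -> tangent_space t (gamma s) (V s) ->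
  cov_deriv t gamma (fun x => a x *: V x) s =
  a s *: cov_deriv t gamma V s + derive1 a s *: V s.
Proof.
move=> da dV tV; rewrite /cov_deriv !derive1E.
have [_ ->] := is_derive_scale_rV (derivableP da) (derivableP dV).
by rewrite tangent_projD !tangent_projZ (tangent_proj_id tV).
Qed.

End CovariantDerivative.

(** * Frenet curves of order at least four *)

Section Frenet.
Context (R : realType) (m t n : nat) (c : R) (o : option bool).
Context (I : set R) (gamma : R -> 'rV[R]_(amb_dim m c)).
Context (eps : nat -> R) (F : nat -> R -> 'rV[R]_(amb_dim m c)).
Context (k : nat -> R -> R).
Hypotheses (hn : (4 <= n)%N) (oI : open I).
Hypothesis Hf : frenet_curve t o n I gamma eps F k.

Local Notation e1 := (eps 1%N).
Local Notation e2 := (eps 2%N).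
Local Notation e3 := (eps 3%N).
Local Notation e4 := (eps 4%N).
Local Notation k1 := (k 1%N : R -> R^o).
Local Notation k2 := (k 2%N : R -> R^o).
Local Notation k3 := (k 3%N : R -> R^o).
Local Notation D := (cov_deriv t gamma).

Let le4n i : (1 <= i <= 4)%N -> (1 <= i <= n)%N.
Proof. by case/andP=> -> /leq_trans->. Qed.

Let lt4n i : (1 <= i < 4)%N -> (1 <= i < n)%N.
Proof. by case/andP=> -> /leq_trans->. Qed.

Lemma frenet_eps_sqr i : (1 <= i <= 4)%N -> eps i * eps i = 1.
Proof. by move=> /le4n/(frenet_eps Hf)[] ->; rewrite ?mulrNN mulr1. Qed.

Lemma frenet_eps_neq0 i : (1 <= i <= 4)%N -> eps i != 0.
Proof.
move=> /frenet_eps_sqr e; apply/eqP => e0.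
by move: e; rewrite e0 mul0r => /eqP; rewrite eq_sym oner_eq0.
Qed.

Lemma frenet_derivable_F i s : (1 <= i <= 4)%N -> I s -> derivable (F i) s 1.
Proof. by move=> /le4n/(frenet_F_smooth Hf) sF /(sF 0%N). Qed.

Lemma frenet_derivable_k i s : (1 <= i < 4)%N -> I s ->
  derivable (k i : R -> R^o) s 1.
Proof. by move=> /lt4n/(frenet_k_smooth Hf) sk /(sk 0%N). Qed.

Lemma frenet_derivable_k' i s : (1 <= i < 4)%N -> I s ->
  derivable (derive1 (k i : R -> R^o)) s 1.
Proof. by move=> /lt4n/(frenet_k_smooth Hf) sk /(sk 1%N). Qed.

(** The strict bound keeps [i] away from the last curvature, the only one whose sign an orientation
    may leave free. As [4 <= n], this covers [k 1] and [k 2]. *)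
Lemma frenet_k_gt0 i s : (1 <= i < n.-1)%N -> I s -> 0 < k i s.
Proof.
move=> /andP[i1 lin] Is; apply: (frenet_k_pos Hf) => //.
  by rewrite i1 (leq_trans lin) ?leq_pred.
by move=> [_ _ ein]; rewrite ein ltnn in lin.
Qed.

(** Serves twice in the computation of [bitension]: the first two covariant derivatives of the
    velocity lie in the span of [F 1], [F 2], [F 3], and the third one brings in [F 4]. *)
Lemma cov_deriv_frame123 (a b d : R -> R^o) s : I s ->
  derivable a s 1 -> derivable b s 1 -> derivable d s 1 ->
  D (fun x => a x *: F 1%N x + b x *: F 2%N x + d x *: F 3%N x) s =
    (derive1 a s - e1 * k1 s * b s) *: F 1%N s
  + (derive1 b s + e2 * k1 s * a s - e2 * k2 s * d s) *: F 2%N s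
  + (derive1 d s + e3 * k2 s * b s) *: F 3%N s
  + (e4 * k3 s * d s) *: F 4%N s.
Proof.
move=> Is da db dd.
have dF (f : R -> R^o) i : (1 <= i <= 4)%N -> derivable f s 1 ->
    derivable (fun x => f x *: F i x) s 1.
  move=> i4 df; have dFi := frenet_derivable_F i4 Is.
  by have [] := is_derive_scale_rV (derivableP df) (derivableP dFi).
have DF (f : R -> R^o) i : (1 <= i <= 4)%N -> derivable f s 1 ->
    D (fun x => f x *: F i x) s = f s *: D (F i) s + derive1 f s *: F i s.
  move=> i4 df; apply: cov_derivZ => //; first exact: frenet_derivable_F.
  exact: (frenet_F_tangent Hf (le4n i4)).
rewrite cov_derivD; [|exact: derivableD (dF _ _ _ _) (dF _ _ _ _)|exact: dF].
rewrite cov_derivD; [|exact: dF|exact: dF].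
rewrite !DF // !(frenet_eq Hf) ?le4n //=.
(* Since [4 <= n], the Frenet equations of [F 1], [F 2] and [F 3] all keep their forward term. *)
rewrite (leq_trans _ hn) // (leq_trans _ hn) // (leq_trans _ hn) //.
by apply/rowP => j; rewrite !mxE; ring.
Qed.

Lemma frenet_bitension s : I s ->
  bitension t gamma s =
    (- 3 * (e1 * e2) * k1 s * derive1 k1 s) *: F 1%N s
  + (e2 * derive1 (derive1 k1) s
     + k1 s * (c * e1 * e2 - (e1 * k1 s ^+ 2 + e3 * k2 s ^+ 2))) *: F 2%N s
  + (e2 * e3 * (2 * derive1 k1 s * k2 s + k1 s * derive1 k2 s)) *: F 3%N s
  + (e2 * e3 * e4 * k1 s * k2 s * k3 s) *: F 4%N s.
Proof.
move=> Is0.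
have E2 := frenet_eps_sqr (isT : 1 <= 2 <= 4)%N.
have DT x : I x -> D (derive1 gamma) x = (e2 * k1 x) *: F 2%N x.
  move=> Ix; rewrite -(eq_on_cov_deriv t gamma oI Ix (frenet_F1 Hf)).
  by rewrite (frenet_eq Hf) ?le4n //= add0r (leq_trans _ hn).
(* The zero function fills the [F 1] and [F 3] slots, so that the multiple of [F 2] in [DT] has the
   shape expected by [cov_deriv_frame123]. *)
pose z : R -> R^o := cst 0.
have dz x : derivable z x 1 by exact: derivable_cst.
have z' x : derive1 z x = 0 by rewrite derive1_cst.
have dk1 x (Ix : I x) := frenet_derivable_k (isT : 1 <= 1 < 4)%N Ix.
have dk2 x (Ix : I x) := frenet_derivable_k (isT : 1 <= 2 < 4)%N Ix.
have dk1' x (Ix : I x) := frenet_derivable_k' (isT : 1 <= 1 < 4)%N Ix.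
have iZ (a : R) (f : R -> R^o) x : derivable f x 1 ->
    is_derive x 1 (fun y => a * f y : R^o) (a * derive1 f x : R^o).
  move=> df; rewrite derive1E; split; first exact: derivableZ df.
  exact: (deriveZ a df).
have iM (f g : R -> R^o) x : derivable f x 1 -> derivable g x 1 ->
    is_derive x 1 (fun y => f y * g y : R^o)
      (f x * derive1 g x + g x * derive1 f x : R^o).
  move=> df dg; rewrite !derive1E; split; first exact: derivableM df dg.
  exact: (deriveM df dg).
pose a x : R^o := (- (e1 * e2)) * (k1 x * k1 x).
pose b x : R^o := e2 * derive1 k1 x.
pose d x : R^o := (e2 * e3) * (k1 x * k2 x).
have DDT x : I x -> D (D (derive1 gamma)) x =
    a x *: F 1%N x + b x *: F 2%N x + d x *: F 3%N x.
  move=> Ix; pose f y : R^o := e2 * k1 y.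
  have [df f'] := iZ e2 k1 x (dk1 x Ix).
  rewrite (eq_on_cov_deriv (W := fun y =>
    z y *: F 1%N y + f y *: F 2%N y + z y *: F 3%N y) t gamma oI Ix); last first.
    by move=> y Iy; rewrite DT // /z /= !scale0r add0r addr0.
  rewrite (cov_deriv_frame123 Ix (dz x) df (dz x)) z' /z /cst.
  rewrite [derive1 f x]derive1E f' /a /b /d.
  by apply/rowP => j; rewrite !mxE /f; ring.
have [dkk1 kk1'] := iM k1 k1 s (dk1 s Is0) (dk1 s Is0).
have [dkk2 kk2'] := iM k1 k2 s (dk1 s Is0) (dk2 s Is0).
have [da a'] := iZ (- (e1 * e2)) (fun x => k1 x * k1 x) s dkk1.
have [db b'] := iZ e2 (derive1 k1) s (dk1' s Is0).
have [dd d'] := iZ (e2 * e3) (fun x => k1 x * k2 x) s dkk2.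
rewrite /bitension (eq_on_cov_deriv t gamma oI Is0 DDT).
rewrite (cov_deriv_frame123 Is0 da db dd) DT //.
rewrite [derive1 a s]derive1E [derive1 b s]derive1E [derive1 d s]derive1E.
rewrite a' b' d' !derive1E kk1' kk2' -!derive1E.
rewrite /curvature sprodZl -(frenet_F1 Hf Is0).
rewrite (frenet_norm Hf) ?le4n // (frenet_orth Hf) ?le4n // mulr0 scale0r subr0.
rewrite /a /b /d; apply/rowP => j; rewrite !mxE.
(* [E2] is needed for the [F 2] coefficient only: its terms in [k1 ^+ 3] and [k1 * k2 ^+ 2] arrive
   with a factor [e2 * e2]. *)
by ring: E2.
Qed.

(** The metric is indefinite, but the frame is orthogonal and nonnull: pairing with [F i] leaves
    [eps i] times the i-th coefficient, and [eps i] squares to 1. *)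
Lemma frenet_free4 (a1 a2 a3 a4 : R) s : I s ->
  a1 *: F 1%N s + a2 *: F 2%N s + a3 *: F 3%N s + a4 *: F 4%N s = 0 ->
  [/\ a1 = 0, a2 = 0, a3 = 0 & a4 = 0].
Proof.
move=> Is a0.
have Fi i : a1 * sprod t (F i s) (F 1%N s) + a2 * sprod t (F i s) (F 2%N s)
    + a3 * sprod t (F i s) (F 3%N s) + a4 * sprod t (F i s) (F 4%N s) = 0.
  (* The zero vector is written as [0 *: 0], so that homogeneity makes its pairing vanish. *)
  by rewrite -!sprodZr -!sprodDr a0 -(scale0r 0) sprodZr mul0r.
have epsK a i : (1 <= i <= 4)%N -> a * eps i = 0 -> a = 0.
  by move=> /frenet_eps_sqr e a0'; rewrite -[a]mulr1 -e mulrA a0' mul0r.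
have F0 i j : (1 <= i <= 4)%N -> (1 <= j <= 4)%N -> i <> j ->
    sprod t (F i s) (F j s) = 0.
  by move=> /le4n i4 /le4n j4 ij; exact: (frenet_orth Hf).
have F1 i : (1 <= i <= 4)%N -> sprod t (F i s) (F i s) = eps i.
  by move=> /le4n i4; exact: (frenet_norm Hf).
split.
- by move: (Fi 1%N); rewrite F1 // !F0 // !mulr0 !addr0; exact: epsK.
- by move: (Fi 2%N); rewrite F1 // !F0 // !mulr0 !addr0 add0r; exact: epsK.
- by move: (Fi 3%N); rewrite F1 // !F0 // !mulr0 !addr0 add0r; exact: epsK.
- by move: (Fi 4%N); rewrite F1 // !F0 // !mulr0 !add0r; exact: epsK.
Qed.

(** At any point of [I] the acceleration is [e2 * k1] times [F 2], with [k1] positive and [F 2]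
    nonzero. This supplies the word proper in the characterization. *)
Lemma frenet_not_geodesic : I !=set0 -> ~ geodesic t I gamma.
Proof.
move=> [s Is] /(_ s Is).
rewrite -(eq_on_cov_deriv t gamma oI Is (frenet_F1 Hf)).
rewrite (frenet_eq Hf) ?le4n //= add0r (leq_trans _ hn) //= => DT0.
have k1s : 0 < k1 s by apply: frenet_k_gt0 => //; case: n hn => [|[|[|]]].
have [|_ + _ _] := @frenet_free4 0 (e2 * k1 s) 0 0 s Is.
  by rewrite DT0 !scale0r !addr0.
move=> /(congr1 (fun x => e2 * x)); rewrite mulrA frenet_eps_sqr // mul1r mulr0.
by move=> k0; rewrite k0 ltxx in k1s.
Qed.

Lemma frenet_biharmonic_curvatures : is_interval I -> I !=set0 ->
  biharmonic t I gamma ->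
  exists kappa1 kappa2 : R,
    [/\ 0 < kappa1 /\ (forall s, I s -> k 1%N s = kappa1),
        0 < kappa2 /\ (forall s, I s -> k 2%N s = kappa2),
        (forall s, I s ->
           e1 * k 1%N s ^+ 2 + e3 * k 2%N s ^+ 2 = c * e1 * e2) &
        (forall s, I s -> e3 * k 2%N s * k 3%N s = 0)].
Proof.
move=> Iitv [s0 Is0] bih.
have k1_gt0 s : I s -> 0 < k 1%N s.
  by apply: frenet_k_gt0; case: n hn => [|[|[|]]].
have k2_gt0 s : I s -> 0 < k 2%N s.
  by apply: frenet_k_gt0; case: n hn => [|[|[|[|]]]].
have e1n0 := frenet_eps_neq0 (isT : 1 <= 1 <= 4)%N.
have e2n0 := frenet_eps_neq0 (isT : 1 <= 2 <= 4)%N.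
have e3n0 := frenet_eps_neq0 (isT : 1 <= 3 <= 4)%N.
have e4n0 := frenet_eps_neq0 (isT : 1 <= 4 <= 4)%N.
have k1n0 s (Is : I s) := lt0r_neq0 (k1_gt0 s Is).
have k2n0 s (Is : I s) := lt0r_neq0 (k2_gt0 s Is).
(* Vanishing of the bitension field is split into four scalar equations, one for each frame
   vector. *)
have coef s (Is : I s) :=
  frenet_free4 Is (etrans (esym (frenet_bitension Is)) (bih s Is)).
have n30 : - 3 != 0 :> R by rewrite oppr_eq0 pnatr_eq0.
have k1' s : I s -> derive1 k1 s = 0.
  move=> Is; have [/eqP + _ _ _] := coef s Is.
  rewrite !mulf_eq0 (negPf n30) (negPf e1n0) (negPf e2n0).
  by rewrite (negPf (k1n0 s Is)) => /eqP.
have k1'' s : I s -> derive1 (derive1 k1) s = 0.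
  by move=> Is; exact: eq_cst_derive1 oI Is k1'.
have k2' s : I s -> derive1 k2 s = 0.
  (* Once [k1] has zero derivative, the [F 3] coefficient reduces to [e2 * e3 * k1] times the
     derivative of [k2]. *)
  move=> Is; have [_ _ /eqP + _] := coef s Is.
  rewrite k1' // mulr0 mul0r add0r.
  rewrite !mulf_eq0 (negPf e2n0) (negPf e3n0) (negPf (k1n0 s Is)).
  by move=> /eqP.
(* The constants are the values at the base point [s0]. *)
exists (k 1%N s0), (k 2%N s0); split.
- split; [exact: k1_gt0|move=> s Is].
  apply: (derive1_eq0_cst Iitv _ k1') => // x Ix.
  exact: frenet_derivable_k.
- split; [exact: k2_gt0|move=> s Is].
  apply: (derive1_eq0_cst Iitv _ k2') => // x Ix.
  exact: frenet_derivable_k.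
- move=> s Is; have [_ /eqP + _ _] := coef s Is.
  rewrite k1'' // mulr0 add0r mulf_eq0 (negPf (k1n0 s Is)) subr_eq0.
  by move=> /eqP.
- move=> s Is; have [_ _ _ /eqP] := coef s Is.
  rewrite -!mulrA !mulf_eq0 (negPf e2n0) (negPf e3n0) (negPf e4n0).
  by rewrite (negPf (k1n0 s Is)) (negPf (k2n0 s Is)) => /eqP ->; rewrite !mulr0.
Qed.

Lemma frenet_curvatures_biharmonic (kappa1 kappa2 : R) :
  (forall s, I s -> k 1%N s = kappa1) -> (forall s, I s -> k 2%N s = kappa2) ->
  (forall s, I s -> e1 * k 1%N s ^+ 2 + e3 * k 2%N s ^+ 2 = c * e1 * e2) ->
  (forall s, I s -> e3 * k 2%N s * k 3%N s = 0) ->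
  biharmonic t I gamma.
Proof.
move=> k1c k2c ksq k23 s Is; rewrite (frenet_bitension Is).
have k1' x : I x -> derive1 k1 x = 0.
  by move=> Ix; exact: eq_cst_derive1 oI Ix k1c.
have k1'' : derive1 (derive1 k1) s = 0 by exact: eq_cst_derive1 oI Is k1'.
have k2' : derive1 k2 s = 0 by exact: eq_cst_derive1 oI Is k2c.
(* Regrouping exposes the product assumed to vanish inside the [F 4] coefficient. *)
have -> : e2 * e3 * e4 * k1 s * k2 s * k3 s =
    e2 * e4 * k1 s * (e3 * k2 s * k3 s) by ring.
rewrite k1'' k2' k1' // ksq // k23 // subrr !(mulr0, mul0r, add0r).
by rewrite !scale0r !addr0.
Qed.

End Frenet.

(** * Characterization of proper biharmonic curves and nonexistence of full ones *)

Theorem corollary1p19 (R : realType) (m t n : nat) (c : R) (o : option bool)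
    (ht : (1 <= t <= m - 1)%N) (hn : (4 <= n <= m)%N) :
  (forall (I : set R) (gamma : R -> 'rV[R]_(amb_dim m c))
      (eps : nat -> R) (F : nat -> R -> 'rV[R]_(amb_dim m c))
      (k : nat -> R -> R),
    open_interval I ->
    frenet_curve t o n I gamma eps F k ->
    (proper_biharmonic t I gamma <->
     exists kappa1 kappa2 : R,
       [/\ 0 < kappa1 /\ (forall s, I s -> k 1%N s = kappa1),
           0 < kappa2 /\ (forall s, I s -> k 2%N s = kappa2),
           (forall s, I s ->
              eps 1%N * k 1%N s ^+ 2 + eps 3%N * k 2%N s ^+ 2
                = c * eps 1%N * eps 2%N) &
           (forall s, I s -> eps 3%N * k 2%N s * k 3%N s = 0)]))
  /\
  ~ (exists (I : set R) (gamma : R -> 'rV[R]_(amb_dim m c))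
        (eps : nat -> R) (F : nat -> R -> 'rV[R]_(amb_dim m c))
        (k : nat -> R -> R),
      [/\ open_interval I,
          frenet_curve t o n I gamma eps F k,
          full_frenet n I k &
          proper_biharmonic t I gamma]).
Proof.
case/andP: hn => n4 _; split=> [I gamma eps F k [oI Iitv In0] Hf|].
  split=> [[bih _]|[a [b [[_ k1c] [_ k2c] ksq k23]]]].
    exact: (frenet_biharmonic_curvatures n4 oI Hf Iitv).
  split; first exact: (frenet_curvatures_biharmonic n4 oI Hf k1c k2c).
  exact: (frenet_not_geodesic n4 oI Hf).
move=> [I [gamma [eps [F [k [[oI Iitv [s Is]] Hf full [bih _]]]]]]].
have [_ [_ [_ _ _ /(_ s Is)/eqP]]] :=
  frenet_biharmonic_curvatures n4 oI Hf Iitv (ex_intro _ s Is) bih.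
apply/negP; rewrite !mulf_neq0 //.
- exact: (frenet_eps_neq0 n4 Hf (i := 3%N)).
- apply: lt0r_neq0; apply: (frenet_k_gt0 Hf) => //.
  by case: (n) n4 => [|[|[|[|]]]].
(* For [n = 4], [k 3] is the last curvature and may be negative in the oriented case, so fullness is
   what makes it nonzero. For larger [n] it is positive by [frenet_k_gt0]. *)
- have [n4E|nn4] := eqVneq n 4%N.
    by apply/eqP; move: (full s Is); rewrite n4E.
  apply: lt0r_neq0; apply: (frenet_k_gt0 Hf) => //.
  by case: (n) n4 nn4 => [|[|[|[|[|]]]]].
Qed.
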